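(* Let $(\mathsf G,\mathsf E,\mathsf w)$ and $(\mathsf G',\mathsf E',\mathsf w')$ be ($\mathbf C$-)continuation frames on $\mathbf D$, and let $\mathsf v\colon\mathsf G\Rightarrow\mathsf G'$ be a natural transformation. Suppose there exists a natural transformation $\widetilde{\mathsf v}\colon\mathsf E\Rightarrow\mathsf E'$ such that $\Pi[\widetilde{\mathsf v}]\colon\Pi[\mathsf E]\to\Pi[\mathsf E']$ is continuous and $\mathsf w'\circ\widetilde{\mathsf v}=\mathsf v\circ\mathsf w$ as natural transformations $\mathsf E\Rightarrow\mathsf G'$. Then $\Pi[\mathsf v]\colon\Pi[\mathsf G]\to\Pi[\mathsf G']$ is a morphism of étale spaces.
   Context: $\mathbf D$ is a category whose set of objects $\mathrm{ob}(\mathbf D)$ is a topological space; $\mathbf C$ is a concrete category (objects treated as sets with structure). A $\mathbf C$-structure on $\mathbf D$ is a contravariant functor $\mathbf D\to\mathbf C$. A $\mathbf C$-structure $\mathsf E$ is considered together with a universe: a constant contravariant functor with value $\mathsf F_0$ and an injective natural transformation from $\mathsf E$ to it, by which each $\mathsf E(\phi)$ is regarded as a subset of $\mathsf F_0$. For $U\in\mathsf F_0$ put $\Phi[\mathsf E;U]=\{\phi\in\mathrm{ob}(\mathbf D):U\in\mathsf E(\phi)\}$. $\mathsf E$ is stable if $\Phi[\mathsf E;U]$ is open for every $U\in\mathsf F_0$. A $\mathbf C$-continuation frame on $\mathbf D$ is a triple $(\mathsf G,\mathsf E,\mathsf w)$ of $\mathbf C$-structures $\mathsf E,\mathsf G$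 and a natural transformation $\mathsf w\colon\mathsf E\Rightarrow\mathsf G$ such that (i) $\mathsf w_\phi\colon\mathsf E(\phi)\to\mathsf G(\phi)$ is surjective for all $\phi$; (ii) $\mathsf E$ is stable; (iii) for all $U,U'\in\mathsf F_0$ the set $\{\phi\in\Phi[\mathsf E;U]\cap\Phi[\mathsf E;U']:\mathsf w_\phi(U)=\mathsf w_\phi(U')\}$ is open. For a $\mathbf C$-structure $\mathsf H$, $\Pi[\mathsf H]$ is the set of pairs $(\phi,S)$ with $S\in\mathsf H(\phi)$, with projection $\pi(\phi,S)=\phi$; a natural transformation $\mathsf n\colon\mathsf H\Rightarrow\mathsf H'$ induces $\Pi[\mathsf n](\phi,S)=(\phi,\mathsf n_\phi(S))$. For a continuation frame, $\Pi[\mathsf G]$ has the topology generated by the sets $\{(\phi,\mathsf w_\phi(U)):\phi\in\Omega\}$ and $\Pi[\mathsf E]$ the topology generated by the sets $\{(\phi,U):\phi\in\Omega\}$, where $U\in\mathsf F_0$ and $\Omega\subset\Phi[\mathsf E;U]$ is open; with these topologies both are étale spaces over $\mathrm{ob}(\mathbf D)$ via $\pi$. A morphism of étale spaces is a continuous map commuting with the projections to $\mathrm{ob}(\mathbf D)$. *)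

(* Defs.v *)
From HB Require Import structures.
From mathcomp Require Import all_boot all_order.
From mathcomp Require Import finmap.
From mathcomp Require Import all_classical.
From mathcomp Require Import topology.

Set Implicit Arguments.
Unset Strict Implicit.
Unset Printing Implicit Defensive.

Local Open Scope classical_set_scope.

(** * Categories *)

Record category (Ob : Type) := Category {
  hom : Ob -> Ob -> Type;
  idm : forall a, hom a a;
  mcomp : forall a b c, hom b c -> hom a b -> hom a c;
  comp1m : forall a b (f : hom a b), mcomp (idm b) f = f;
  compm1 : forall a b (f : hom a b), mcomp f (idm a) = f;
  mcompA : forall a b c d (h : hom c d) (g : hom b c) (f : hom a b),
    mcomp h (mcomp g f) = mcomp (mcomp h g) f
}.
Arguments idm {_} _ _.

(* A concrete category is a category with a faithful functor to sets; a set is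
   a type, and [carrier], [cmap] are the object and morphism parts of that
   functor. *)
Record concrete_category := ConcreteCategory {
  cob :> Type;
  ccat : category cob;
  carrier : cob -> Type;
  cmap : forall a b, hom ccat a b -> carrier a -> carrier b;
  cmap_id : forall a x, cmap (idm ccat a) x = x;
  cmap_comp : forall a b c (g : hom ccat b c) (f : hom ccat a b) x,
    cmap (mcomp g f) x = cmap g (cmap f x);
  cmap_faithful : forall a b (f g : hom ccat a b),
    (forall x, cmap f x = cmap g x) -> f = g
}.
Arguments carrier {_} _.
Arguments cmap {_ a b} _ _.

(** * C-structures on D, where [B] is the space of objects of [D] *)

Record structure (B : topologicalType) (D : category B)
    (C : concrete_category) := MkStructure {
  sob :> B -> C;
  smap : forall phi psi : B, hom D phi psi -> hom (ccat C) (sob psi) (sob phi);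
  smap_id : forall phi, smap (idm D phi) = idm (ccat C) (sob phi);
  smap_comp : forall phi psi chi (g : hom D psi chi) (f : hom D phi psi),
    smap (mcomp g f) = mcomp (smap f) (smap g)
}.
Arguments smap {B D C} _ {phi psi} _.

Section Structures.
Context {B : topologicalType} {D : category B} {C : concrete_category}.
Implicit Types E G H K : structure D C.

Record nattrans E H := Nattrans {
  ncomp : forall phi : B, hom (ccat C) (E phi) (H phi);
  ncomp_natural : forall (phi psi : B) (f : hom D phi psi),
    mcomp (ncomp phi) (smap E f) = mcomp (smap H f) (ncomp psi)
}.

Definition napp E H (n : nattrans E H) (phi : B) :
  carrier (E phi) -> carrier (H phi) := cmap (ncomp n phi).

Definition nattrans_id H : nattrans H H.
Proof.
exists (fun phi => idm (ccat C) (H phi)) => phi psi f.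
by rewrite comp1m compm1.
Defined.

Definition nattrans_comp E H K (m : nattrans H K) (n : nattrans E H) :
  nattrans E K.
Proof.
exists (fun phi => mcomp (ncomp m phi) (ncomp n phi)) => phi psi f.
by rewrite -mcompA ncomp_natural mcompA ncomp_natural mcompA.
Defined.

Definition const_structure (F0 : C) : structure D C.
Proof.
exists (fun=> F0) (fun _ _ _ => idm (ccat C) F0) => // phi psi chi g f.
by rewrite comp1m.
Defined.

Record universe E := Universe {
  uob : C;
  uincl : nattrans E (const_structure uob);
  uincl_inj : forall phi, injective (napp uincl (phi := phi))
}.

Set Strict Implicit.

(* [E phi], viewed as a subset of the universe. *)
Definition uset E (u : universe E) (phi : B) : set (carrier (uob u)) :=
  range (napp (uincl u) (phi := phi)).

Definition Phi E (u : universe E) (U : carrier (uob u)) : set B :=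
  [set phi | uset u phi U].

Unset Strict Implicit.

Definition stable E (u : universe E) := forall U, open (Phi u U).

(* [phi] belongs to [Phi[E; U]] and [Phi[E; U']], and [w_phi U = w_phi U'].
   The arguments of [w_phi] are the (unique) elements of [E phi] which the
   inclusion into the universe sends to [U] and [U']. *)
Definition agree E G (u : universe E) (w : nattrans E G)
    (U U' : carrier (uob u)) : set B :=
  [set phi | exists S S' : carrier (E phi),
    [/\ napp (uincl u) S = U, napp (uincl u) S' = U' & napp w S = napp w S']].

Definition Pi H : Type := {phi : B & carrier (H phi)}.

Definition Pi_proj H (x : Pi H) : B := projT1 x.

Definition Pi_map H K (n : nattrans H K) (x : Pi H) : Pi K :=
  existT _ (projT1 x) (napp n (projT2 x)).

(* For [Omega] included in [Phi u U], this is
   {(phi, w_phi U) : phi \in Omega}. *)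
Definition sheet E H (u : universe E) (w : nattrans E H)
    (U : carrier (uob u)) (Omega : set B) : set (Pi H) :=
  [set x | exists S : carrier (E (projT1 x)),
    [/\ Omega (projT1 x), napp (uincl u) S = U & projT2 x = napp w S]].

Definition sheets E H (u : universe E) (w : nattrans E H) : set (set (Pi H)) :=
  [set A | exists U Omega,
    [/\ open Omega, Omega `<=` Phi u U & A = sheet w U Omega]].

End Structures.

(* The set [Pi H] with the topology generated by the sheets of [w : E => H]. *)
Definition sheet_space (B : topologicalType) (D : category B)
  (C : concrete_category) (E H : structure D C) (u : universe E)
  (w : nattrans E H) : Type := Pi H.

Section SheetSpace.
Context (B : topologicalType) (D : category B) (C : concrete_category).
Context (E H : structure D C) (u : universe E) (w : nattrans E H).

HB.instance Definition _ := gen_eqMixin (sheet_space u w).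
HB.instance Definition _ := gen_choiceMixin (sheet_space u w).
HB.instance Definition _ :=
  isSubBaseTopological.Build (sheet_space u w) (sheets u w) id.

End SheetSpace.

(** * Continuation frames *)

Record is_frame (B : topologicalType) (D : category B) (C : concrete_category)
    (G E : structure D C) (u : universe E) (w : nattrans E G) : Prop := IsFrame {
  is_frame_surj : forall phi (S : carrier (G phi)), exists S', napp w S' = S;
  is_frame_stable : stable u;
  is_frame_agree : forall U U' : carrier (uob u), open (agree w U U')
}.

Record continuation_frame (B : topologicalType) (D : category B)
    (C : concrete_category) := ContinuationFrame {
  frG : structure D C;
  frE : structure D C;
  frU : universe frE;
  frw : nattrans frE frG;
  frP : is_frame frU frw
}.

(** * Etale spaces *)

Definition local_homeomorphism (X Y : topologicalType) (p : X -> Y) :=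
  forall x, exists (W : set X) (q : Y -> X),
    [/\ open W, W x, open (p @` W),
        {within W, continuous p} &
        {within p @` W, continuous q} /\ (forall y, W y -> q (p y) = y)].

Record etale_space (B : topologicalType) := EtaleSpace {
  etale_total :> topologicalType;
  etale_proj : etale_total -> B;
  etale_projP : local_homeomorphism etale_proj
}.
Arguments etale_proj {B} _ _.

Definition etale_morphism (B : topologicalType) (X Y : etale_space B)
    (f : X -> Y) : Prop :=
  continuous f /\ forall x, etale_proj Y (f x) = etale_proj X x.

Section SheetTopology.
Context {B : topologicalType} {D : category B} {C : concrete_category}.
Context {G E : structure D C} {u : universe E} {w : nattrans E G}.

Lemma open_sheet U (Omega : set B) : open Omega -> Omega `<=` Phi u U ->
  open (sheet w U Omega : set (sheet_space u w)).
Proof.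
move=> oO sO.
pose A : set (sheet_space u w) := sheet w U Omega.
exists (set1 A); last by rewrite bigcup_set1.
move=> _ ->; exists [fset A]%fset.
  by move=> A'; rewrite !inE => ->; exists U, Omega.
by rewrite set_fset1 bigcap_set1.
Qed.

Lemma sheet_basis (Fw : is_frame u w) (W : set (sheet_space u w)) x :
  open W -> W x ->
  exists U Omega, [/\ open Omega, Omega `<=` Phi u U,
    sheet w U Omega x & sheet w U Omega `<=` W].
Proof.
case=> D' sD' <- [A D'A Ax]; have [DA sDA DAA] := sD' _ D'A.
suff [U [O [oO sO Ox sub]]] : exists U Omega, [/\ open Omega,
    Omega `<=` Phi u U, sheet w U Omega x &
    forall i, i \in enum_fset DA -> sheet w U Omega `<=` i].
  exists U, O; split=> // y Oy; exists A => //.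
  by have : A y by rewrite -DAA => i /= /sub; exact.
have xDA i : i \in enum_fset DA -> sheets u w i /\ i x.
  move=> iDA; split; first by have /set_mem := sDA i iDA.
  by move: Ax; rewrite -DAA; apply.
elim: (enum_fset DA) xDA => [_|i s IHs xDA].
  case: x {Ax} => phi S; have [S' S'S] := is_frame_surj Fw S.
  exists (napp (uincl u) S'), (Phi u (napp (uincl u) S')); split=> //.
    exact: (is_frame_stable Fw).
  by exists S'; rewrite S'S; split=> //; exists S'.
have [j js|U [O [oO sO Ox sub]]] := IHs.
  by apply: xDA; rewrite inE js orbT.
have [[U' [O' [oO' sO' ieq]]] ix] := xDA i (mem_head _ _).
exists U, (O `&` O' `&` agree w U U'); split.
- by apply: openI; [exact: openI|exact: (is_frame_agree Fw)].
- by move=> phi [[/sO]].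
- rewrite ieq in ix; case: Ox ix => S [Ox SU xS] [S' [O'x S'U xS']].
  exists S; split=> //; split=> //.
  by exists S, S'; rewrite -xS -xS'.
- move=> j; rewrite inE => /orP [/eqP ->|/sub sj].
    rewrite ieq => y [S [[[Oy O'y] [S1 [S2 [S1U S2U' S12]]]] SU yS]].
    exists S2; split=> //; rewrite yS -S12; congr napp.
    by apply: (@uincl_inj _ _ _ _ u); rewrite SU.
  move=> y [S [[[Oy O'y] _] SU yS]]; apply: sj.
  by exists S.
Qed.

Lemma frame_etale (Fw : is_frame u w) :
  local_homeomorphism (@Pi_proj B D C G : sheet_space u w -> B).
Proof.
move=> [phi0 T0]; have [S0 wS0] := is_frame_surj Fw T0.
set U : carrier (uob u) := napp (uincl u) S0; set W := sheet w U (Phi u U).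
have [q qE] : exists q : B -> sheet_space u w,
    forall phi (S : carrier (E phi)),
      napp (uincl u) S = U -> q phi = existT _ phi (napp w S).
  have /choice [q qP] : forall phi, exists x : sheet_space u w,
      forall S : carrier (E phi), napp (uincl u) S = U -> x = existT _ phi (napp w S).
    move=> phi; have [[S SU]|nS] :=
        pselect (exists S : carrier (E phi), napp (uincl u) S = U); last first.
      by exists (existT _ phi0 T0) => S SU; case: nS; exists S.
    exists (existT _ phi (napp w S)) => S' S'U; suff -> : S' = S by [].
    by apply: (@uincl_inj _ _ _ _ u); rewrite SU.
  by exists q.
have oPhi := is_frame_stable Fw U.
have oW : open (W : set (sheet_space u w)) by exact: open_sheet.
have pW : @Pi_proj B D C G @` W = Phi u U.
  rewrite eqEsubset; split=> [_ [x [S [? _ _]] <-] //|phi [S _ SU]].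
  by exists (existT _ phi (napp w S)) => //; exists S; split=> //; exists S.
exists W, q; rewrite pW; split=> //.
- by exists S0; split=> //; exists S0.
- rewrite continuous_open_subspace//; apply/(continuous_inP _ oW) => O oO.
  rewrite (_ : _ `&` _ = sheet w U (O `&` Phi u U)); last first.
    rewrite eqEsubset; split=> [x [[S [Px SU xS]] Ox]|x [S [[Ox Px] SU xS]]].
      by exists S.
    by split=> //; exists S.
  by apply: open_sheet; [exact: openI|exact: subIsetr].
split=> [|x [S [_ SU xS]]]; last first.
  by rewrite (qE _ _ SU); case: x S SU xS => phi T /= S _ ->.
rewrite continuous_open_subspace//; apply/(continuous_inP _ oPhi) => V oV.
rewrite openE => phi [[S _ SU]]; rewrite /= (qE _ _ SU) => Vphi.
have [U' [O [oO sO [S1 [/= Ophi S1U' SS1]] sub]]] := sheet_basis Fw oV Vphi.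
rewrite /interior nbhsE; exists (O `&` agree w U U').
  split; first by apply: openI => //; exact: (is_frame_agree Fw).
  by split=> //; exists S, S1.
- move=> psi [Opsi [R [R' [RU R'U' RR']]]]; split; first by exists R.
  rewrite /= (qE _ _ RU); apply: sub.
  by exists R'.
Qed.

End SheetTopology.

Section EtaleFrame.
Context {B : topologicalType} {D : category B} {C : concrete_category}.

Lemma is_frame_id (G E : structure D C) (u : universe E) (w : nattrans E G) :
  is_frame u w -> is_frame u (nattrans_id E).
Proof.
have idE phi (S : carrier (E phi)) : napp (nattrans_id E) S = S by exact: cmap_id.
move=> Fw; split=> [phi S||U U']; first by exists S.
  exact: is_frame_stable Fw.
have [->|UU'] := pselect (U = U').
  rewrite (_ : agree _ _ _ = Phi u U'); first exact: is_frame_stable Fw _.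
  rewrite eqEsubset; split=> [phi [S [_ [SU _ _]]]|phi [S _ SU]].
    by exists S.
  by exists S, S.
rewrite (_ : agree _ _ _ = set0); first exact: open0.
rewrite -subset0 => phi [S [S' [SU S'U']]]; rewrite !idE => SS'.
by apply: UU'; rewrite -SU -S'U' SS'.
Qed.

Definition PiG (F : continuation_frame D C) : etale_space B :=
  EtaleSpace (frame_etale (frP F)).

(* The sheets of the identity of [E] are the sets {(phi, U) : phi \in Omega}. *)
Definition PiE (F : continuation_frame D C) : etale_space B :=
  EtaleSpace (frame_etale (is_frame_id (frP F))).

End EtaleFrame.

(* Main.v *)
Require Import Defs.
From mathcomp Require Import all_boot all_order.
From mathcomp Require Import all_classical.
From mathcomp Require Import topology.

(** The map [Pi_map w] from [Pi E] to [Pi G] of a continuation frame is a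
    continuous open surjection ([Pi_map_frame_continuous],
    [Pi_map_frame_open], [Pi_map_frame_surj]), hence a topological quotient
    map.  A map out of a quotient is continuous as soon as its composite with
    the quotient map is, and here
      [Pi_map v \o Pi_map w = Pi_map w' \o Pi_map vt]
    is a composite of continuous maps.  Compatibility with the projections
    holds by definition, since [Pi_map v] does not move the base point. *)

Local Open Scope classical_set_scope.

Lemma Pi_map_comp (B : topologicalType) (D : category B)
    (C : concrete_category) (E H K : structure D C)
    (m : nattrans H K) (n : nattrans E H) (x : Pi E) :
  Pi_map (nattrans_comp m n) x = Pi_map m (Pi_map n x).
Proof. by rewrite /Pi_map /napp /= cmap_comp. Qed.

Section FrameMap.
Context {B : topologicalType} {D : category B} {C : concrete_category}.
Context {G E : structure D C} {u : universe E} {w : nattrans E G}.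

Lemma Pi_map_frame_surj (Fw : is_frame u w) (y : Pi G) : exists x : Pi E, Pi_map w x = y.
Proof.
case: y => phi T; have [S <-] := is_frame_surj Fw T.
by exists (existT _ phi S).
Qed.

(** If [w_phi] sends [U0] to the value at [phi] of the sheet of [U], it does so
    on the whole set where [U] and [U0] agree; the agreement axiom of frames
    says that this set is open. *)
Lemma Pi_map_frame_continuous (Fw : is_frame u w) :
  continuous (Pi_map w : sheet_space u (nattrans_id E) -> sheet_space u w).
Proof.
apply/continuousP => V oV; rewrite openE => -[phi T] Vx.
have [U [O [oO sO [S /= [Ophi SU TS]] sub]]] := sheet_basis Fw oV Vx.
set U0 := napp (uincl u) T.
rewrite /interior nbhsE /=.
exists (sheet (nattrans_id E) U0 (O `&` agree w U U0)).
  split; last first.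
    exists T; split=> //=; last by rewrite /napp cmap_id.
    by split=> //; exists S, T.
  apply: open_sheet; first by apply: openI => //; exact: (is_frame_agree Fw).
  by move=> psi [_ [_ [R [_ RU0 _]]]]; exists R.
move=> [psi T'] [T1 /= [[Opsi [R [R' [RU R'U0 RR']]]] T1U0 ->]].
apply: sub; exists R; split=> //=.
rewrite RR' /napp cmap_id -/(napp w T1); congr napp.
by apply: (@uincl_inj _ _ _ _ u); rewrite T1U0.
Qed.

Lemma image_sheet (U : carrier (uob u)) (O : set B) :
  Pi_map w @` sheet (nattrans_id E) U O = sheet w U O.
Proof.
rewrite eqEsubset; split=> [_ [[phi T] [S /= [Ophi SU ->]] <-]|].
  by exists S; split=> //=; rewrite /napp cmap_id.
move=> [phi T] [S /= [Ophi SU ->]]; exists (existT _ phi S) => //.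
by exists S; split=> //=; rewrite /napp cmap_id.
Qed.

(** The sheets are a basis, and [Pi_map w] carries sheets of [Pi E] onto sheets
    of [Pi G]. *)
Lemma Pi_map_frame_open (Fw : is_frame u w)
    (V : set (sheet_space u (nattrans_id E))) :
  open V -> open (Pi_map w @` V : set (sheet_space u w)).
Proof.
move=> oV; rewrite openE => _ [x Vx <-].
have [U [O [oO sO Ox sub]]] := sheet_basis (is_frame_id Fw) oV Vx.
rewrite /interior nbhsE; exists (sheet w U O).
  by split; [exact: open_sheet|rewrite -image_sheet; exists x].
by rewrite -image_sheet; exact: image_subset.
Qed.

End FrameMap.

Theorem proposition4p9 (B : topologicalType) (D : category B)
    (C : concrete_category) (F F' : continuation_frame D C)
    (v : nattrans (frG F) (frG F')) :
  (exists vt : nattrans (frE F) (frE F'),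
     continuous (Pi_map vt : PiE F -> PiE F') /\
     nattrans_comp (frw F') vt = nattrans_comp v (frw F)) ->
  etale_morphism (Pi_map v : PiG F -> PiG F').
Proof.
move=> [vt [cvt vtE]]; split=> //; apply/continuousP => V oV.
have square x : Pi_map v (Pi_map (frw F) x) = Pi_map (frw F') (Pi_map vt x).
  by rewrite -!Pi_map_comp vtE.
(* By surjectivity of [Pi_map w], a subset of [Pi G] is the image of its own
   preimage. *)
have -> : Pi_map v @^-1` V =
    Pi_map (frw F) @` (Pi_map vt @^-1` (Pi_map (frw F') @^-1` V)).
  rewrite eqEsubset; split=> [y|_ [x Vx <-]]; last by rewrite /= square.
  have [x <-] := Pi_map_frame_surj (frP F) y.
  by rewrite /= square => Vx; exists x.
apply: (Pi_map_frame_open (frP F)).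
move/continuousP: cvt; apply.
by move/continuousP: (Pi_map_frame_continuous (frP F')); apply.
Qed.
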